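(* Let $n\geqslant 3$ be an integer, and for $0\leqslant y\leqslant 1$ let $$F_A(y)=2y^n+ny^{n-1}(1-y)-((2y-1)^+)^n-n((2y-1)^+)^{n-1}(1-y).$$ Define the operator $\Omega:\mathcal{L}\rightarrow\mathcal{L}$, for $F\in\mathcal{L}$ and $0\leqslant x\leqslant 1$, by \begin{align*} \Omega F(x)&=F_A(x)-\int_{(2x-1)^+}^x\int_0^{\frac{1+y}{2}-x}2n(n-1)y^{n-2}F(z)\,dz\,dy\\ &\quad-\int_{\max\{(x-\frac{1}{4})^+,\,2x-1\}}^{x}\int_0^{\min\{\frac{1}{4}+y-x,\,\frac{1+y}{2}-x\}}2n(n-1)\left((3y-2x-2z)^+\right)^{n-2}F(z)\,dz\,dy\\ &\quad+\int_{\max\{\frac{1}{2},\,2x-1\}}^{\max\{\frac{1}{2},\,x\}}\int_0^{\frac{1+y}{2}-x}4n(n-1)(2y-1)^{n-2}F(z)\,dz\,dy. \end{align*} Then $\Omega$ is a contraction mapping on $\mathcal{L}$ with a contraction constant $C_n$ that is bounded from above by $\frac{11}{12}$; that is, there is $C_n\leqslant\frac{11}{12}$ with $\|\Omega F_1-\Omega F_2\|\leqslant C_n\|F_1-F_2\|$ for all $F_1,F_2\in\mathcal{L}$.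
   Context: $\mathcal{L}=\mathcal{L}^\infty([0,1])$ denotes the space of all measurable and bounded (real-valued) functions on $[0,1]$, endowed with the sup norm $\|F\|=\sup_{x\in[0,1]}|F(x)|$. Notation: $u^+=\max\{0,u\}$. *)

(* Defs.v *)
From mathcomp Require Import all_boot all_order all_algebra.
From mathcomp Require Import all_classical all_reals all_analysis.
Set Implicit Arguments.
Unset Strict Implicit.
Unset Printing Implicit Defensive.
Import Order.TTheory GRing.Theory Num.Theory.
Import numFieldNormedType.Exports.
Local Open Scope classical_set_scope.
Local Open Scope ring_scope.

(* The real line with the Lebesgue (completed Borel) sigma-algebra: the
   measurable type on which [completed_lebesgue_measure] is defined. *)
Definition lebesgue_line (R : realType) :=
  caratheodory_type (@wlength R idfun)^*%mu.

(* The integral of f from a to b, only used for a <= b. *)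
Definition interval_integral (R : realType) (a b : R) (f : R -> R) : R :=
  \int[@completed_lebesgue_measure R]_(t in
    (`[a, b]%classic : set (lebesgue_line R))) f t.

(* Functions on [0, 1] are represented by functions on R whose values outside
   [0, 1] are ignored, by the integrals in [Omega] as well. *)
Definition Linfty (R : realType) : set (R -> R) :=
  [set F : R -> R |
    measurable_fun (`[0, 1]%classic : set (lebesgue_line R)) (F : _ -> R)
    /\ [bounded F x | x in (`[0, 1]%classic : set R)]].

Definition sup_norm (R : realType) (F : R -> R) : R :=
  sup [set `|F x| | x in (`[0, 1]%classic : set R)].

Definition contraction_on_Linfty (R : realType) (C : R)
    (T : (R -> R) -> (R -> R)) : Prop :=
  [/\ 0 <= C, C < 1, set_fun (@Linfty R) (@Linfty R) T
    & forall F1 F2, Linfty F1 -> Linfty F2 ->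
        sup_norm (T F1 \- T F2) <= C * sup_norm (F1 \- F2)].

Definition pos_part (R : realType) (u : R) : R := Num.max 0 u.

Notation "u ^\p" := (pos_part u) (at level 2, format "u ^\p") : ring_scope.

Definition FA (R : realType) (n : nat) (y : R) : R :=
  2 * y ^+ n + n%:R * y ^+ (n - 1) * (1 - y)
  - (2 * y - 1)^\p ^+ n - n%:R * (2 * y - 1)^\p ^+ (n - 1) * (1 - y).

(* For 0 <= x <= 1 the lower limit of each integral is at most the upper one;
   when x <= 1/2, the last outer integral is over the point 1/2. *)
Definition Omega (R : realType) (n : nat) (F : R -> R) (x : R) : R :=
  FA n x
  - interval_integral (2 * x - 1)^\p x (fun y =>
      interval_integral 0 ((1 + y) / 2 - x) (fun z =>
        2 * n%:R * (n%:R - 1) * y ^+ (n - 2) * F z))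
  - interval_integral (Num.max (x - 1 / 4)^\p (2 * x - 1)) x (fun y =>
      interval_integral 0 (Num.min (1 / 4 + y - x) ((1 + y) / 2 - x)) (fun z =>
        2 * n%:R * (n%:R - 1) * (3 * y - 2 * x - 2 * z)^\p ^+ (n - 2) * F z))
  + interval_integral (Num.max (1 / 2) (2 * x - 1)) (Num.max (1 / 2) x) (fun y =>
      interval_integral 0 ((1 + y) / 2 - x) (fun z =>
        4 * n%:R * (n%:R - 1) * (2 * y - 1) ^+ (n - 2) * F z)).

(* Main.v *)
(* The difference of two values of Omega is the sum of three iterated integrals
   of F1 - F2 against explicit kernels, each bounded by the sup norm of F1 - F2
   times the mass of its kernel. With w = (2x - 1)^+, the masses of the first
   and third kernels are A(x) and A(w) / 2, where
   A(x) = n (1 - x) x^(n-1) - x^n + w^n, and that of the second one is at most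
   x^n / 3. Expanding (x + (1 - x))^n = 1 shows that n (1 - x) x^(n-1) is at
   most 1/2 and at most 1 - x^n; with w <= x^2 this bounds the total by 3/4.
   The integrability needed to subtract the integrals, and the measurability of
   Omega F, hold because every integral is a Lipschitz function of its
   parameters when F is bounded. *)
Require Import Defs.
From mathcomp Require Import all_boot all_order all_algebra.
From mathcomp Require Import all_classical all_reals all_analysis.
From mathcomp Require Import measurable_realfun.
From mathcomp Require Import ring lra.
Set Implicit Arguments.
Unset Strict Implicit.
Unset Printing Implicit Defensive.
Import Order.TTheory GRing.Theory Num.Theory.
Import numFieldNormedType.Exports.
Local Open Scope classical_set_scope.
Local Open Scope ring_scope.

(** * Integrals over the Lebesgue line *)

Section LebesgueLine.
Context (R : realType).
Local Notation line := (lebesgue_line R).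
Local Notation mu := (@completed_lebesgue_measure R).
Implicit Types (a b t : R) (f g : R -> R).

(** Borel sets are Carathéodory measurable. Composing with this identity carries Borel
    measurability, in particular that of continuous functions, to the Lebesgue line. *)
Lemma measurable_fun_line_id :
  measurable_fun setT (id : line -> measurableTypeR R).
Proof. by move=> _ A mA; rewrite setTI; exact: sub_caratheodory. Qed.

Lemma measurable_line_itv a b : measurable (`[a, b]%classic : set line).
Proof. by apply: sub_caratheodory; exact: (@measurable_itv R `[a, b]). Qed.

Lemma completed_measure_itv a b :
  mu (`[a, b]%classic : set line) = (Num.max 0 (b - a))%:E.
Proof.
transitivity (@lebesgue_measure R `[a, b]%classic); first by [].
rewrite lebesgue_measure_itv /= lte_fin.
case: ltP => ab; first by rewrite -EFinB max_r ?subr_ge0 ?ltW.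
by rewrite max_l ?subr_le0.
Qed.

(** Lebesgue measure on the Borel sets is the pushforward of the completed measure under the
    identity. This brings the fundamental theorem of calculus to the completed measure. *)
Lemma ge0_integral_lineE a b f :
  measurable_fun (`[a, b]%classic : set (measurableTypeR R)) f ->
  (forall t, t \in `[a, b] -> 0 <= f t) ->
  (\int[mu]_(t in (`[a, b]%classic : set line)) (f t)%:E =
   \int[@lebesgue_measure R]_(t in `[a, b]) (f t)%:E)%E.
Proof.
move=> mf f0.
have mI : measurable (`[a, b]%classic : set (measurableTypeR R)).
  exact: (@measurable_itv R `[a, b]).
rewrite -(@ge0_integral_pushforward _ _ line (measurableTypeR R) R id
  measurable_fun_line_id mu `[a, b]%classic (EFin \o f) mI) //.
- exact/measurable_EFinP.
- by move=> t; rewrite inE /= => tab; rewrite lee_fin f0.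
Qed.

(** The fundamental theorem of calculus. Every majorant below is the derivative of an explicit
    polynomial, so its integral is a difference of two values. *)
Lemma ge0_integral_line_deriv a b (p : {poly R}) : a <= b ->
  (forall t, a <= t <= b -> 0 <= p^`().[t]) ->
  (\int[mu]_(t in (`[a, b]%classic : set line)) (p^`().[t])%:E =
   (p.[b] - p.[a])%:E)%E.
Proof.
move=> ab g0; rewrite ge0_integral_lineE; first last.
- by move=> t; rewrite in_itv /=; exact: g0.
- apply: measurable_funTS.
  exact: (continuous_measurable_fun (@continuous_horner R p^`())).
move: ab; rewrite le_eqVlt => /predU1P[<-|ab].
  by rewrite set_itv1 integral_set1 subrr.
rewrite (@continuous_FTC2 _ (horner p^`()) (horner p)) ?EFinB //.
- exact: (continuous_subspaceT (@continuous_horner R p^`())).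
- split.
  + by move=> t _; exact: derivable_horner.
  + by apply: cvg_at_right_filter; exact: continuous_horner.
  + by apply: cvg_at_left_filter; exact: continuous_horner.
- by move=> t _; rewrite derive1E; have := is_derive_poly p t => -[].
Qed.

Lemma Linfty_bound f : Linfty f ->
  exists2 M, 0 <= M & forall t, 0 <= t <= 1 -> `|f t| <= M.
Proof.
(* Boundedness gives the estimate only for numbers strictly above [M], hence the [+ 1]. *)
move=> [_ [M [_ Mf]]]; exists (`|M| + 1) => [|t t01]; first by rewrite addr_ge0.
apply: Mf; first by rewrite ltr_pwDr// ler_norm.
by rewrite /= in_itv.
Qed.

Lemma LinftyI f M :
  measurable_fun (`[0, 1]%classic : set line) (f : _ -> R) ->
  (forall t, 0 <= t <= 1 -> `|f t| <= M) -> Linfty f.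
Proof.
move=> mf Mf; split=> //; exists M; split; first exact: num_real.
by move=> x Mx t; rewrite /= in_itv /= => /Mf /le_trans; apply; exact: ltW.
Qed.

Lemma itv01_sub a b : 0 <= a -> b <= 1 -> `[a, b] `<=` `[0, 1].
Proof.
move=> a0 b1 t; rewrite /= !in_itv /= => /andP[at_ tb].
by rewrite (le_trans a0)// (le_trans tb).
Qed.

Lemma integrable_Linfty a b f : 0 <= a -> b <= 1 -> Linfty f ->
  mu.-integrable (`[a, b]%classic : set line) (EFin \o f).
Proof.
move=> a0 b1 [mf [M [Mr Mf]]]; apply: measurable_bounded_integrable.
- exact: measurable_line_itv.
- by rewrite [X in (X < _)%E]completed_measure_itv ltry.
- apply: measurable_funS mf; [exact: measurable_line_itv|exact: itv01_sub].
- by exists M; split=> // x Mx t /(itv01_sub a0 b1); exact: Mf.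
Qed.

(* The interval [a', b'] carrying the majorant may differ from [a, b]: this
   integrates positive parts over the interval where they do not vanish. *)
Lemma dist_integral_le a b a' b' f1 f2 (p : {poly R}) :
  0 <= a -> b <= 1 -> a' <= b' -> Linfty f1 -> Linfty f2 ->
  (forall t, a' <= t <= b' -> 0 <= p^`().[t]) ->
  (forall t, a <= t <= b ->
    f1 t = f2 t \/ a' <= t <= b' /\ `|f1 t - f2 t| <= p^`().[t]) ->
  `|interval_integral a b f1 - interval_integral a b f2| <= p.[b'] - p.[a'].
Proof.
move=> a0 b1 ab' Lf1 Lf2 g0 f12.
have i1 := integrable_Linfty a0 b1 Lf1; have i2 := integrable_Linfty a0 b1 Lf2.
have mI := measurable_line_itv a b; have mJ := measurable_line_itv a' b'.
have iB : mu.-integrable (`[a, b]%classic : set line) (EFin \o (f1 \- f2)).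
  by have := integrableB mI i1 i2; apply: eq_integrable.
rewrite /interval_integral -RintegralB// -lee_fin.
rewrite (EFin_normr_Rintegral mI iB) -(ge0_integral_line_deriv ab' g0).
have [mB _] := integrableP _ _ _ iB.
apply: le_trans (le_abse_integral _ mI mB) _.
(* The two intervals may differ, so both integrands are extended by zero to the whole line and
   compared pointwise there. *)
rewrite integral_mkcond [leRHS]integral_mkcond.
apply: ge0_le_integral; first exact: measurableT.
- by move=> t _; rewrite patchE; case: ifP => // _; exact: abse_ge0.
- apply/(measurable_restrictT _ mI)/measurableT_comp => //; exact: mB.
- apply/(measurable_restrictT _ mJ); apply/measurable_EFinP.
  apply: (@measurable_funTS _ _ line R).
  apply: measurableT_comp measurable_fun_line_id.
  exact: (continuous_measurable_fun (@continuous_horner R p^`())).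
- move=> t _; rewrite !patchE; case: ifPn => [|_]; last first.
    by case: ifPn => //; rewrite inE /= in_itv /= => tJ; rewrite lee_fin g0.
  rewrite inE /= in_itv /= => /f12[->|[tJ le_g]].
    rewrite /= subrr normr0; case: ifPn => //; rewrite inE /= in_itv /= => tJ.
    by rewrite lee_fin g0.
  by rewrite mem_set /= ?in_itv //= lee_fin.
Qed.

End LebesgueLine.

(** * Comparison of integrals over two different intervals *)

Section TwoIntervals.
Context (R : realType).
Local Notation line := (lebesgue_line R).
Local Notation mu := (@completed_lebesgue_measure R).
Implicit Types (a b t : R) (f : R -> R).

Lemma Rintegral_indic_itv a b :
  \int[mu]_t (\1_(`[a, b]%classic : set line) t) = Num.max 0 (b - a).
Proof.
rewrite /Rintegral integral_indic//; last exact: measurable_line_itv.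
by rewrite setIT [X in fine X]completed_measure_itv.
Qed.

Lemma integrable_indic_line a b :
  mu.-integrable setT (EFin \o (\1_(`[a, b]%classic : set line) : line -> R)).
Proof.
apply/integrableP; split.
  by apply/measurable_EFinP/measurable_indic; exact: measurable_line_itv.
under eq_integral do rewrite /= ger0_norm //.
rewrite integral_indic//; last exact: measurable_line_itv.
by rewrite setIT [X in (X < _)%E]completed_measure_itv ltry.
Qed.

Lemma subr_max_min a b :
  Num.max 0 (Num.max a b - Num.min a b) = `|a - b|.
Proof.
case: (leP a b) => ab; rewrite max_r ?subr_ge0 ?(ltW ab)//.
- by rewrite distrC ger0_norm ?subr_ge0.
- by rewrite gtr0_norm ?subr_gt0.
Qed.

(** A point outside the closed interval spanned by [a] and [b] lies on the same side of both. *)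
Lemma between_le a b t : ~~ (Num.min a b <= t <= Num.max a b) ->
  (a <= t) = (b <= t) /\ (t <= a) = (t <= b).
Proof.
case: (leP a b) => ab; rewrite negb_and -!ltNge => /orP[] lt_t.
- have tb := lt_le_trans lt_t ab.
  by rewrite !leNgt lt_t tb /= -!leNgt (ltW lt_t) (ltW tb).
- have at_ := le_lt_trans ab lt_t.
  by rewrite (ltW lt_t) (ltW at_) !leNgt lt_t at_.
- have tb := lt_trans lt_t ab.
  by rewrite !leNgt lt_t tb /= -!leNgt (ltW lt_t) (ltW tb).
- have at_ := lt_trans ab lt_t.
  by rewrite (ltW lt_t) (ltW at_) !leNgt lt_t at_.
Qed.

Lemma Rintegral_line_mkcond a b f : interval_integral a b f =
  \int[mu]_t ((\1_(`[a, b]%classic : set line) t) * f t).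
Proof.
rewrite /interval_integral Rintegral_mkcond; apply: eq_Rintegral => t _.
by rewrite patchE indicE; case: ifP => _; rewrite ?mul1r ?mul0r.
Qed.

Lemma integrable_Linfty_indic a b f : 0 <= a -> b <= 1 -> Linfty f ->
  mu.-integrable setT
    (EFin \o (fun t => (\1_(`[a, b]%classic : set line) t) * f t)).
Proof.
move=> a0 b1 Lf; have mI := measurable_line_itv a b.
have := integrable_Linfty a0 b1 Lf.
rewrite -[X in mu.-integrable X](setTI (`[a, b]%classic : set line)).
move/(integrable_restrict _ mI measurableT); apply: eq_integrable => // t _.
by rewrite patchE /= indicE; case: ifP => _; rewrite ?mul1r ?mul0r.
Qed.

(** On the common part the integrands differ by at most [e]. The symmetric difference of the two
    intervals is covered by the interval between the left ends and the one between the right ends,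
    where a single integrand of size at most [M] remains. *)
Lemma dist_integral2 a1 b1 a2 b2 f1 f2 M e :
  0 <= a1 -> b1 <= 1 -> 0 <= a2 -> b2 <= 1 -> Linfty f1 -> Linfty f2 ->
  (forall t, 0 <= t <= 1 -> `|f1 t| <= M) ->
  (forall t, 0 <= t <= 1 -> `|f2 t| <= M) ->
  (forall t, 0 <= t <= 1 -> `|f1 t - f2 t| <= e) ->
  `|interval_integral a1 b1 f1 - interval_integral a2 b2 f2|
    <= e + M * (`|a1 - a2| + `|b1 - b2|).
Proof.
move=> a10 b11 a20 b21 L1 L2 M1 M2 f12.
have e0 : 0 <= e by rewrite (le_trans _ (f12 0 _)) ?lexx ?ler01.
have M0 : 0 <= M by rewrite (le_trans _ (M1 0 _)) ?lexx ?ler01.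
have i1 := integrable_Linfty_indic a10 b11 L1.
have i2 := integrable_Linfty_indic a20 b21 L2.
pose h a b t : R := \1_(`[a, b]%classic : set line) t.
pose am := Num.min a1 a2; pose aM := Num.max a1 a2.
pose bm := Num.min b1 b2; pose bM := Num.max b1 b2.
have i01 := integrable_indic_line 0 1.
have ia := integrable_indic_line am aM; have ib := integrable_indic_line bm bM.
have iZ k a b : mu.-integrable setT (EFin \o (fun t => k * h a b t)).
  by have := integrableZl measurableT k (integrable_indic_line a b);
     apply: eq_integrable.
have iD u v : mu.-integrable setT (EFin \o u) ->
    mu.-integrable setT (EFin \o v) ->
    mu.-integrable setT (EFin \o (u \+ v : line -> R)).
  by move=> iu iv; have := integrableD measurableT iu iv; apply: eq_integrable.
have iN u v : mu.-integrable setT (EFin \o u) ->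
    mu.-integrable setT (EFin \o v) ->
    mu.-integrable setT (EFin \o (u \- v : line -> R)).
  by move=> iu iv; have := integrableB measurableT iu iv; apply: eq_integrable.
(* The bound is the integral of a step function, which dominates the difference of the integrands
   pointwise. *)
have -> : e + M * (`|a1 - a2| + `|b1 - b2|) =
    \int[mu]_t (e * h 0 1 t + M * h am aM t + M * h bm bM t).
  rewrite !RintegralD//; [|exact: iD..].
  rewrite !RintegralZl// !Rintegral_indic_itv subr0 /am /aM /bm /bM.
  by rewrite (max_r ler01) mulr1 !subr_max_min mulrDr addrA.
rewrite !Rintegral_line_mkcond -RintegralB//.
apply: le_trans (le_normr_Rintegral measurableT (iN _ _ i1 i2)) _.
apply: le_Rintegral => //.
- by have := integrable_norm (iN _ _ i1 i2); apply: eq_integrable.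
- exact: (iD _ _ (iD _ _ (iZ _ _ _) (iZ _ _ _)) (iZ _ _ _)).
move=> t _.
have hE a b : h a b t = (a <= t <= b)%R%:R.
  by rewrite /h indicE mem_setE in_itv.
change (`|h a1 b1 t * f1 t - h a2 b2 t * f2 t| <=
  e * h 0 1 t + M * h am aM t + M * h bm bM t); rewrite !hE.
have [t01|t01] := boolP (0 <= t <= 1)%R; last first.
  have out a b : 0 <= a -> b <= 1 -> (a <= t <= b)%R = false.
    move=> a_ge0 b_le1; apply: contraNF t01 => /andP[a_le le_b].
    by rewrite (le_trans a_ge0) ?(le_trans le_b).
  rewrite (out a1 b1)// (out a2 b2)//.
  by rewrite !mul0r subrr normr0 mulr0 add0r addr_ge0 ?mulr_ge0.
have [[h1 h2] h3] := (M1 _ t01, M2 _ t01, f12 _ t01).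
have p1 : 0 <= M * (am <= t <= aM)%R%:R by rewrite mulr_ge0.
have p2 : 0 <= M * (bm <= t <= bM)%R%:R by rewrite mulr_ge0.
rewrite mulr1.
(* Memberships in the two intervals can disagree only between the two left ends or between the two
   right ends. *)
have key : (a1 <= t <= b1)%R != (a2 <= t <= b2)%R ->
    (am <= t <= aM)%R || (bm <= t <= bM)%R.
  apply: contraNT; rewrite negb_or => /andP[/between_le[-> _]].
  by move=> /between_le[_ ->].
have big : (am <= t <= aM)%R || (bm <= t <= bM)%R ->
    M <= M * (am <= t <= aM)%R%:R + M * (bm <= t <= bM)%R%:R.
  by case/orP => ->; rewrite mulr1 ?lerDl ?lerDr.
case: (a1 <= t <= b1)%R (a2 <= t <= b2)%R key => -[] key;
  rewrite ?mul1r ?mul0r ?subr0 ?sub0r ?subrr ?normrN ?normr0 /=;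
  rewrite -addrA.
- by apply: le_trans h3 _; rewrite lerDl addr_ge0.
- by apply: le_trans h1 (le_trans (big (key isT)) _); rewrite lerDr.
- by apply: le_trans h2 (le_trans (big (key isT)) _); rewrite lerDr.
- by rewrite !addr_ge0.
Qed.
End TwoIntervals.

(** * Lipschitz dependence on parameters *)

Section Lipschitz.
Context (R : realType).
Local Notation line := (lebesgue_line R).
Implicit Types (a b t : R).

Lemma dist_max a b c d :
  `|Num.max a b - Num.max c d| <= `|a - c| + `|b - d| :> R.
Proof.
have h (u v : R) : u - v <= `|u - v| /\ v - u <= `|u - v|.
  by split; [exact: ler_norm | rewrite distrC ler_norm].
have [[h1 h2] [h3 h4]] := (h a c, h b d).
by rewrite ler_norml; case: (leP a b); case: (leP c d) => *;
  apply/andP; split; lra.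
Qed.

Definition lip1 (f : R -> R) := exists2 K, 0 <= K &
  forall s t, 0 <= s <= 1 -> 0 <= t <= 1 -> `|f s - f t| <= K * `|s - t|.

(** Outside [0, 1] nothing is known of [f]. Composed with the clamp [c] onto [0, 1] it becomes
    continuous on the whole line and keeps its values on [0, 1]. *)
Lemma lip1_Linfty f : lip1 f -> Linfty f.
Proof.
move=> [K K0 Kf]; pose c t := Num.max 0 (Num.min t 1) : R.
have c01 t : 0 <= c t <= 1.
  by rewrite /c le_max lexx ge_max ler01 ge_min lexx orbT.
have cE t : 0 <= t <= 1 -> c t = t.
  by move=> /andP[t0 t1]; rewrite /c (min_l t1) (max_r t0).
have cK s t : `|c s - c t| <= `|s - t|.
  apply: le_trans (dist_max _ _ _ _) _; rewrite subrr normr0 add0r.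
  rewrite -[X in X - _]opprK -[X in _ - X]opprK !oppr_min -opprD normrN.
  apply: le_trans (dist_max _ _ _ _) _.
  by rewrite subrr normr0 addr0 -opprD normrN.
apply: (@LinftyI _ _ (`|f 0| + K)).
  have : continuous (f \o c).
    move=> t; apply/cvgrPdist_lt => e e0; near=> s.
    apply: le_lt_trans (Kf _ _ (c01 _) (c01 _)) _.
    (* The factor [K + 1] is positive even when [K = 0], so one can divide by it. *)
    apply: (@le_lt_trans _ _ ((K + 1) * `|t - s|)).
      by apply: ler_pM => //; rewrite lerDl.
    rewrite mulrC -ltr_pdivlMr ?ltr_wpDl//.
    near: s; apply: cvgr_dist_lt; first exact: cvg_id.
    by rewrite divr_gt0 ?ltr_wpDl.
  move=> /continuous_measurable_fun mfc.
  apply: (@eq_measurable_fun _ _ line R _ (f \o c)).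
    by move=> t; rewrite inE /= in_itv /= => t01; rewrite cE.
  apply: (@measurable_funTS _ _ line R).
  exact: (measurableT_comp mfc (@measurable_fun_line_id R)).
move=> t t01; have := Kf t 0 t01; rewrite lexx ler01 subr0 => /(_ isT) h.
rewrite -[f t](subrK (f 0)) addrC; apply: le_trans (ler_normD _ _) _.
rewrite lerD2l; apply: le_trans h _; rewrite ler_piMr//.
by case/andP: t01 => t0 t1; rewrite ger0_norm.
Unshelve. all: by end_near. Qed.

(* Points (x, y, z): the argument x of Omega, then the outer and the inner
   integration variables. *)
Definition cube (p : R * R * R) :=
  [/\ 0 <= p.1.1 <= 1, 0 <= p.1.2 <= 1 & 0 <= p.2 <= 1].

Definition dist1 (p q : R * R * R) : R :=
  `|p.1.1 - q.1.1| + `|p.1.2 - q.1.2| + `|p.2 - q.2|.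

(** This class is closed under arithmetic, [max], [min], and integration between Lipschitz limits
    that stay in [0, 1]. It therefore contains every integral in [Omega], and measurability follows
    from continuity. *)
Definition lip3 (f : R * R * R -> R) := exists2 K, 0 <= K &
  forall p q, cube p -> cube q -> `|f p - f q| <= K * dist1 p q.

Lemma dist1_le3 p q : cube p -> cube q -> dist1 p q <= 3.
Proof.
move=> [/andP[? ?] /andP[? ?] /andP[? ?]] [/andP[? ?] /andP[? ?] /andP[? ?]].
have h (u v : R) : 0 <= u -> u <= 1 -> 0 <= v -> v <= 1 -> `|u - v| <= 1.
  by move=> *; rewrite ler_norml; apply/andP; split; lra.
by rewrite /dist1 -(_ : 1 + 1 + 1 = 3) ?lerD ?h//; ring.
Qed.

Lemma cube0 : cube (0, 0, 0). Proof. by split; rewrite /= lexx ler01. Qed.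

Lemma lip3_bound f : lip3 f ->
  exists2 M, 0 <= M & forall p, cube p -> `|f p| <= M.
Proof.
move=> [K K0 Kf]; exists (`|f (0, 0, 0)| + K * 3).
  by rewrite addr_ge0 ?mulr_ge0.
move=> p cp; rewrite -[f p](subrK (f (0, 0, 0))) addrC.
apply: le_trans (ler_normD _ _) _; rewrite lerD2l.
apply: le_trans (Kf _ _ cp cube0) _; rewrite ler_wpM2l//.
exact: dist1_le3 cp cube0.
Qed.

Lemma lip3_cst c : lip3 (fun=> c).
Proof. by exists 0 => // p q _ _; rewrite subrr normr0 mul0r. Qed.

Lemma lip3_1 : lip3 (fun p => p.1.1).
Proof.
by exists 1 => // p q _ _; rewrite mul1r /dist1 -addrA lerDl addr_ge0.
Qed.

Lemma lip3_2 : lip3 (fun p => p.1.2).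
Proof.
by exists 1 => // p q _ _; rewrite mul1r /dist1 addrAC lerDr addr_ge0.
Qed.

Lemma lip3_3 : lip3 (fun p => p.2).
Proof. by exists 1 => // p q _ _; rewrite mul1r /dist1 lerDr addr_ge0. Qed.

(** Common source of the closure under sums, differences, [max] and [min], all of which are
    1-Lipschitz in each argument. *)
Lemma lip3_le2 f g h : lip3 f -> lip3 g ->
  (forall p q, cube p -> cube q ->
    `|h p - h q| <= `|f p - f q| + `|g p - g q|) -> lip3 h.
Proof.
move=> [K K0 Kf] [L L0 Lg] hfg; exists (K + L); first exact: addr_ge0.
move=> p q cp cq; apply: le_trans (hfg p q cp cq) _; rewrite mulrDl.
by apply: lerD; [exact: Kf|exact: Lg].
Qed.

Lemma lip3D f g : lip3 f -> lip3 g -> lip3 (fun p => f p + g p).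
Proof.
move=> lf lg; apply: (lip3_le2 lf lg) => p q _ _.
by rewrite opprD addrACA ler_normD.
Qed.

Lemma lip3B f g : lip3 f -> lip3 g -> lip3 (fun p => f p - g p).
Proof.
move=> lf lg; apply: (lip3_le2 lf lg) => p q _ _.
rewrite [`|g p - _|]distrC.
have -> : f p - g p - (f q - g q) = (f p - f q) + (g q - g p) by ring.
exact: ler_normD.
Qed.

Lemma lip3_max f g : lip3 f -> lip3 g -> lip3 (fun p => Num.max (f p) (g p)).
Proof.
by move=> lf lg; apply: (lip3_le2 lf lg) => p q _ _; exact: dist_max.
Qed.

Lemma lip3_min f g : lip3 f -> lip3 g -> lip3 (fun p => Num.min (f p) (g p)).
Proof.
move=> lf lg; apply: (lip3_le2 lf lg) => p q _ _.
rewrite -[X in X - _]opprK -[X in _ - X]opprK !oppr_min -opprD normrN.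
apply: le_trans (dist_max _ _ _ _) _.
by rewrite -!opprD !normrN.
Qed.

(** Lipschitz functions are bounded on the cube, which controls the two parts of the product rule
    for differences. *)
Lemma lip3M f g : lip3 f -> lip3 g -> lip3 (fun p => f p * g p).
Proof.
move=> lf lg; have [M M0 Mf] := lip3_bound lf; have [N N0 Ng] := lip3_bound lg.
have [[K K0 Kf] [L L0 Lg]] := (lf, lg).
exists (K * N + M * L) => [|p q cp cq]; first by rewrite addr_ge0 ?mulr_ge0.
have -> : f p * g p - f q * g q = (f p - f q) * g p + f q * (g p - g q) by ring.
apply: le_trans (ler_normD _ _) _; rewrite !normrM mulrDl.
rewrite [K * N * _]mulrAC -[M * L * _]mulrA.
by apply: lerD; apply: ler_pM => //; [exact: Kf|exact: Ng|exact: Mf|exact: Lg].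
Qed.

Lemma lip3X f n : lip3 f -> lip3 (fun p => f p ^+ n).
Proof.
move=> lf; elim: n => [|n IHn]; first exact: lip3_cst.
by under eq_fun do rewrite exprS; exact: lip3M.
Qed.

Lemma lip3_pos f : lip3 f -> lip3 (fun p => (f p)^\p).
Proof. by move=> lf; apply: lip3_max => //; exact: lip3_cst. Qed.

(** Integration always runs over the last coordinate. This moves the outer variable y there once z
    has been integrated out, and 0 fills the free slot. *)
Lemma lip3_comp12 f : lip3 f -> lip3 (fun p => f (p.1.1, p.2, 0)).
Proof.
move=> [K K0 Kf]; exists K => // p q [p1 _ p3] [q1 _ q3].
apply: le_trans (Kf _ _ _ _) _; try by split; rewrite //= lexx ler01.
by rewrite ler_wpM2l// /dist1 /= subrr normr0 addr0 lerD2r lerDl.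
Qed.

Lemma lip3_lip1 f x y : lip3 f -> 0 <= x <= 1 -> 0 <= y <= 1 ->
  lip1 (fun t => f (x, y, t)).
Proof.
move=> [K K0 Kf] x01 y01; exists K => // s t s01 t01.
apply: le_trans (Kf _ _ _ _) _ => //.
by rewrite /dist1 /= !subrr normr0 !add0r.
Qed.

Lemma Linfty_mul f g : Linfty f -> Linfty g -> Linfty (fun t => f t * g t).
Proof.
move=> Lf Lg; have [[M M0 Mf] [N N0 Ng]] := (Linfty_bound Lf, Linfty_bound Lg).
apply: (@LinftyI _ _ (M * N)) => [|t t01]; last first.
  by rewrite normrM; apply: ler_pM => //; [exact: Mf|exact: Ng].
by case: Lf Lg => mf _ [mg _]; exact: measurable_funM.
Qed.

(** Regularity comes from the kernel and the limits, while [F] is merely measurable and bounded: the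
    kernel contributes [K * M] to the constant and the limits contribute [N * M * (A + B)]. *)
Lemma lip3_integral (a b k : R * R * R -> R) F :
  lip3 a -> lip3 b -> lip3 k -> Linfty F ->
  (forall p, cube p -> 0 <= a p) -> (forall p, cube p -> b p <= 1) ->
  lip3 (fun p => interval_integral (a p) (b p) (fun t => k (p.1, t) * F t)).
Proof.
move=> [A A0 Aa] [B B0 Bb] lk LF a0 b1.
have [M M0 MF] := Linfty_bound LF; have [N N0 Nk] := lip3_bound lk.
have [K K0 Kk] := lk.
exists (K * M + N * M * (A + B)) => [|p q cp cq].
  by rewrite !(addr_ge0, mulr_ge0).
have cpt r t : cube r -> 0 <= t <= 1 -> cube (r.1, t) by move=> [? ? ?].
have L r : cube r -> Linfty (fun t => k (r.1, t) * F t).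
  case: r => -[x y] z [x01 y01 _].
  exact: (Linfty_mul (lip1_Linfty (lip3_lip1 lk x01 y01)) LF).
have bd r t : cube r -> 0 <= t <= 1 -> `|k (r.1, t) * F t| <= N * M.
  by move=> cr t01; rewrite normrM; apply: ler_pM => //;
    [apply/Nk/cpt|exact: MF].
apply: le_trans (@dist_integral2 _ _ _ _ _ _ _ (N * M) (K * M * dist1 p q)
  (a0 _ cp) (b1 _ cp) (a0 _ cq) (b1 _ cq) (L _ cp) (L _ cq) _ _ _) _.
- by move=> t; exact: bd.
- by move=> t; exact: bd.
- move=> t t01; rewrite -mulrBl normrM mulrAC.
  apply: ler_pM => //; last exact: MF.
  apply: le_trans (Kk _ _ (cpt _ _ cp t01) (cpt _ _ cq t01)) _.
  by rewrite ler_wpM2l// /dist1 /= subrr normr0 addr0 lerDl.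
- rewrite mulrDl lerD2l -[N * M * (A + B) * _]mulrA.
  rewrite ler_wpM2l ?mulr_ge0// mulrDl.
  by apply: lerD; [exact: Aa|exact: Bb].
Qed.

Lemma Linfty_cst c : Linfty (fun=> c : R).
Proof. by apply: (@LinftyI _ _ `|c|) => // t _; exact: lexx. Qed.

(** The outer integration is the previous case with the inner integral as kernel and the constant 1
    as [F]. *)
Lemma lip3_integral2 (a b f : R * R * R -> R) : lip3 a -> lip3 b -> lip3 f ->
  (forall p, cube p -> 0 <= a p) -> (forall p, cube p -> b p <= 1) ->
  lip3 (fun p => interval_integral (a p) (b p) (fun t => f (p.1.1, t, 0))).
Proof.
move=> la lb lf a0 b1.
have := lip3_integral la lb (lip3_comp12 lf) (Linfty_cst 1) a0 b1.
by congr lip3; apply/funext => p; congr interval_integral; apply/funext => t;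
  rewrite mulr1.
Qed.

End Lipschitz.

(** * The mass of the kernel *)

Section KernelMass.
Context (R : realType).
Implicit Types (x d : R).

(* Three of the terms in the expansion of (x + d)^(m + 2) = 1. *)
Lemma binomial3_le1 m x d : 0 <= x -> 0 <= d -> x + d = 1 ->
  x ^+ m.+2 + m.+2%:R * x ^+ m.+1 * d
    + m.+2%:R * m.+1%:R / 2 * x ^+ m * d ^+ 2 <= 1.
Proof.
move=> x0 d0 xd; elim: m => [|m IHm].
  rewrite -[leRHS](expr1n _ 2) -[in leRHS]xd le_eqVlt.
  by apply/orP/or_introl/eqP; field.
apply: le_trans IHm.
set u := leRHS; rewrite -[u]mulr1 -[X in _ <= _ * X]xd {}/u !exprS -subr_ge0.
(* By Pascal's rule, the sum for exponent m + 2 times x + d is the sum for exponent m + 3 plus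
   exactly this cubic term in d. *)
apply: (@le_trans _ _ (m.+2%:R * m.+1%:R / 2 * x ^+ m * d ^+ 3)).
  by rewrite !mulr_ge0 ?exprn_ge0.
rewrite le_eqVlt; apply/orP/or_introl/eqP.
by rewrite !exprS -(natr1 m.+2) -(natr1 m.+1) -(natr1 m); field.
Qed.

(** The three binomial terms with d = 1 - x, the nonnegative quadratic one being dropped. *)
Lemma mulrn_onem_expr_le m x : 0 <= x <= 1 ->
  m.+2%:R * (1 - x) * x ^+ m.+1 <= 1 - x ^+ m.+2.
Proof.
move=> /andP[x0 x1]; have d0 : 0 <= 1 - x by rewrite subr_ge0.
have := binomial3_le1 m x0 d0 (subrKC _ _).
have : 0 <= m.+2%:R * m.+1%:R / 2 * x ^+ m * (1 - x) ^+ 2.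
  by rewrite !mulr_ge0 ?exprn_ge0.
rewrite mulrAC; lra.
Qed.

(** The middle one of the three binomial terms is at most the sum of the other two, hence at most
    half of the total. *)
Lemma mulrn_onem_expr_le_half m x : 0 <= x <= 1 ->
  m.+2%:R * (1 - x) * x ^+ m.+1 <= 1 / 2.
Proof.
move=> /andP[x0 x1]; have d0 : 0 <= 1 - x by rewrite subr_ge0.
have := binomial3_le1 m x0 d0 (subrKC _ _).
set d := 1 - x.
(* With N = m + 2, this completes the square in x^2 - N x d + N (N - 1) / 2 d^2; the remainder is N
   (N - 2) / 4 d^2. *)
have : 0 <= x ^+ m *
    ((x - m.+2%:R * d / 2) ^+ 2 + m.+2%:R * m%:R / 4 * d ^+ 2).
  by rewrite mulr_ge0 ?exprn_ge0// addr_ge0 ?sqr_ge0// !mulr_ge0 ?exprn_ge0.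
rewrite -(natr1 m.+1) -(natr1 m) !exprS; lra.
Qed.

Lemma kernel_mass_le m x (w := (2 * x - 1)^\p : R) : 0 <= x <= 1 ->
  (m.+3%:R * (1 - x) * x ^+ m.+2 - x ^+ m.+3 + w ^+ m.+3) + x ^+ m.+3 / 3
    + (m.+3%:R * (1 - w) * w ^+ m.+2 - w ^+ m.+3 + (2 * w - 1)^\p ^+ m.+3) / 2
  <= 3 / 4.
Proof.
have wE : w = (2 * x - 1)^\p by []; clearbody w.
have [n nE] : exists n, n = m.+3 by exists m.+3.
rewrite -nE => x01; have /andP[x0 x1] := x01.
have w0 : 0 <= w by rewrite wE /pos_part le_max lexx.
(* From (x - 1)^2 >= 0; it makes w^n at most the square of x^n. *)
have wx2 : w <= x ^+ 2.
  rewrite wE /pos_part ge_max exprn_ge0//=.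
  have := sqr_ge0 (x - 1); rewrite !expr2; lra.
have w1 : w <= 1 by rewrite (le_trans wx2)// exprn_ile1.
have v0 : 0 <= (2 * w - 1)^\p by rewrite /pos_part le_max lexx.
have vw : (2 * w - 1)^\p <= w by rewrite /pos_part ge_max w0 /=; lra.
have vwn : (2 * w - 1)^\p ^+ n <= w ^+ n by rewrite lerXn2r// nnegrE.
have w01 : 0 <= w <= 1 by rewrite w0.
have aw := @mulrn_onem_expr_le_half m.+1 w w01.
have ax := @mulrn_onem_expr_le_half m.+1 x x01.
have ax' := @mulrn_onem_expr_le m.+1 x x01.
have wn : w ^+ n <= x ^+ n * x ^+ n.
  by rewrite -expr2 exprAC lerXn2r// nnegrE// exprn_ge0.
have q0 : 0 <= x ^+ n by rewrite exprn_ge0.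
have q1 : x ^+ n <= 1 by rewrite exprn_ile1.
move: ax ax' aw; rewrite -nE.
set ax := n%:R * (1 - x) * _; set aw := n%:R * (1 - w) * _ => h1 h2 h3.
(* With q = x^n, it remains to show ax + q^2 - 2q/3 <= 1/2. For q <= 2/3 the bound ax <= 1/2
   suffices; for larger q, ax <= 1 - q together with (1 - q)(q - 2/3) >= 0. *)
have [q2|q2] := leP (x ^+ n) (2 / 3).
  have : 0 <= x ^+ n * (2 / 3 - x ^+ n) by rewrite mulr_ge0 ?subr_ge0.
  rewrite mulrBr; lra.
have : 0 <= (1 - x ^+ n) * (x ^+ n - 2 / 3).
  by rewrite mulr_ge0 ?subr_ge0// ltW.
rewrite mulrBr !mulrBl; lra.
Qed.
End KernelMass.

(** * The three integral terms of Omega *)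

Section Terms.
(* Powers and multiples come before products and sums, whose rules would
   otherwise apply to them after unfolding. *)
Local Definition derivF :=
  (derivX, derivC, derivD, derivN, derivZ, deriv_exp, derivM).
Local Definition hornerF :=
  (hornerX, hornerC, hornerMn, horner_exp, hornerN, hornerZ, hornerD, hornerM).
Context (R : realType).
Implicit Types (x y t u S : R) (F : R -> R).

(** The inner integral is Lipschitz in y; this supplies the integrability needed to subtract outer
    integrals. *)
Lemma Linfty_inner (k c : R * R * R -> R) F x : lip3 k -> lip3 c ->
  (forall p, cube p -> c p <= 1) -> Linfty F -> 0 <= x <= 1 ->
  Linfty (fun y => interval_integral 0 (c (x, y, 0))
    (fun z => k (x, y, z) * F z)).
Proof.
move=> lk lc c1 LF x01; apply: lip1_Linfty.
have h := lip3_integral (lip3_cst 0) lc lk LF (fun _ _ => lexx 0) c1.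
by apply: (lip3_lip1 (lip3_comp12 h) x01 (y := 0)); rewrite lexx ler01.
Qed.

Lemma lip3_iterated (k a b c : R * R * R -> R) F :
  lip3 k -> lip3 a -> lip3 b -> lip3 c ->
  (forall p, cube p -> 0 <= a p) -> (forall p, cube p -> b p <= 1) ->
  (forall p, cube p -> c p <= 1) -> Linfty F ->
  lip3 (fun p => interval_integral (a p) (b p) (fun y =>
    interval_integral 0 (c (p.1.1, y, 0)) (fun z => k (p.1.1, y, z) * F z))).
Proof.
move=> lk la lb lc a0 b1 c1 LF.
have h := lip3_integral (lip3_cst 0) lc lk LF (fun _ _ => lexx 0) c1.
exact: (lip3_integral2 la lb h a0 b1).
Qed.

(** Kernels and inner upper limits are functions of a point (x, y, z), the form that the Lipschitz
    lemmas take. The letters A, B, C follow the order of the integrals in [Omega]. *)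
Definition kerA n (p : R * R * R) : R :=
  2 * n%:R * (n%:R - 1) * p.1.2 ^+ (n - 2).
Definition kerB n (p : R * R * R) : R := 2 * n%:R * (n%:R - 1) *
  (3 * p.1.2 - 2 * p.1.1 - 2 * p.2)^\p ^+ (n - 2).
Definition kerC n (p : R * R * R) : R :=
  4 * n%:R * (n%:R - 1) * (2 * p.1.2 - 1) ^+ (n - 2).
Definition bndA (p : R * R * R) : R := (1 + p.1.2) / 2 - p.1.1.
Definition bndB (p : R * R * R) : R :=
  Num.min (1 / 4 + p.1.2 - p.1.1) ((1 + p.1.2) / 2 - p.1.1).

Definition termA n F x := interval_integral (2 * x - 1)^\p x (fun y =>
  interval_integral 0 (bndA (x, y, 0)) (fun z => kerA n (x, y, z) * F z)).
Definition termB n F x :=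
  interval_integral (Num.max (x - 1 / 4)^\p (2 * x - 1)) x (fun y =>
  interval_integral 0 (bndB (x, y, 0)) (fun z => kerB n (x, y, z) * F z)).
Definition termC n F x :=
  interval_integral (Num.max (1 / 2) (2 * x - 1)) (Num.max (1 / 2) x) (fun y =>
  interval_integral 0 (bndA (x, y, 0)) (fun z => kerC n (x, y, z) * F z)).

Lemma OmegaE n F x :
  Omega n F x = FA n x - termA n F x - termB n F x + termC n F x.
Proof. by []. Qed.

Ltac lip := repeat first [exact: lip3_cst | exact: lip3_1 | exact: lip3_2
  | exact: lip3_3 | apply: lip3B | apply: lip3D | apply: lip3_pos
  | apply: lip3_max | apply: lip3_min | apply: lip3X | apply: lip3M].

Lemma lip3_kerA n : lip3 (kerA n). Proof. by rewrite /kerA; lip. Qed.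
Lemma lip3_kerB n : lip3 (kerB n). Proof. by rewrite /kerB; lip. Qed.
Lemma lip3_kerC n : lip3 (kerC n). Proof. by rewrite /kerC; lip. Qed.
Lemma lip3_bndA : lip3 bndA. Proof. by rewrite /bndA; lip. Qed.
Lemma lip3_bndB : lip3 bndB. Proof. by rewrite /bndB; lip. Qed.

Lemma bndA_le1 p : cube p -> bndA p <= 1.
Proof. move=> [/andP[? ?] /andP[? ?] _]; rewrite /bndA; lra. Qed.

Lemma bndB_le1 p : cube p -> bndB p <= 1.
Proof. by move=> cp; rewrite /bndB ge_min -/(bndA p) bndA_le1 ?orbT. Qed.

Lemma lip3_Omega n F : Linfty F -> lip3 (fun p => Omega n F p.1.1).
Proof.
move=> LF; under eq_fun do rewrite OmegaE.
apply: lip3D; [apply: lip3B; [apply: lip3B|]|].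
- rewrite /FA; lip.
- apply: (lip3_iterated (lip3_kerA n) _ _ lip3_bndA _ _ bndA_le1 LF).
  + by lip.
  + by lip.
  + by move=> p _; rewrite le_max lexx.
  + by move=> p [/andP[]].
- apply: (lip3_iterated (lip3_kerB n) _ _ lip3_bndB _ _ bndB_le1 LF).
  + by lip.
  + by lip.
  + by move=> p _; rewrite !le_max lexx.
  + by move=> p [/andP[]].
- apply: (lip3_iterated (lip3_kerC n) _ _ lip3_bndA _ _ bndA_le1 LF).
  + by lip.
  + by lip.
  + by move=> p _; rewrite le_max divr_ge0.
  + by move=> p [/andP[_ ?] _ _]; rewrite ge_max; apply/andP; split; lra.
Qed.

Lemma Linfty_Omega n F : Linfty F -> Linfty (Omega n F).
Proof.
move=> /(lip3_Omega n) [K K0 Kf]; apply: lip1_Linfty.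
exists K => // s t s01 t01.
apply: le_trans (Kf (s, 0, 0) (t, 0, 0) _ _) _;
  try by split; rewrite //= lexx ler01.
by rewrite /dist1 /= !subrr normr0 !addr0.
Qed.

(** * Each term bounded by the mass of its kernel *)

Section Bounds.
Variables (m : nat) (F1 F2 : R -> R) (S : R).
Hypotheses (L1 : Linfty F1) (L2 : Linfty F2).
Hypothesis dS : forall t, 0 <= t <= 1 -> `|F1 t - F2 t| <= S.

Let S0 : 0 <= S.
Proof.
by apply: le_trans (normr_ge0 _) (dS (t := 0) _); rewrite lexx ler01.
Qed.

(** For the first and third kernels, which do not depend on z: the inner mass is the kernel times
    the length of the interval. *)
Lemma dist_inner_cst c b : 0 <= c -> 0 <= b <= 1 ->
  `|interval_integral 0 b (fun z => c * F1 z)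
    - interval_integral 0 b (fun z => c * F2 z)| <= S * (c * b).
Proof.
move=> c0 /andP[b0 b1].
have pE z : ((S * c) *: 'X)^`().[z] = S * c.
  by rewrite derivZ derivX hornerZ hornerC mulr1.
have LM F : Linfty F -> Linfty (fun z => c * F z).
  by move=> LF; exact: (Linfty_mul (Linfty_cst c) LF).
have -> : S * (c * b) = ((S * c) *: 'X).[b] - ((S * c) *: 'X).[0].
  by rewrite !hornerZ !hornerX mulr0 subr0 mulrA.
apply: (dist_integral_le (lexx 0) b1 b0 (LM _ L1) (LM _ L2)) => t.
  by rewrite pE mulr_ge0.
move=> /andP[t0 tb]; right; split; first by rewrite t0.
rewrite pE -mulrBr normrM (ger0_norm c0) mulrC ler_wpM2r//.
by apply/dS/andP; split; [|exact: le_trans tb b1].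
Qed.

Local Notation n := m.+3.

Lemma dist_termA x : 0 <= x <= 1 ->
  `|termA n F1 x - termA n F2 x| <= S * (n%:R * (1 - x) * x ^+ m.+2
     - x ^+ n + (2 * x - 1)^\p ^+ n).
Proof.
move=> x01; have /andP[x0 x1] := x01.
(* [S] times a primitive of the inner mass in y, found by integrating by parts. *)
pose p : {poly R} := S *: ((2 * n%:R) *: ('X ^+ m.+2 *
  ((1 / 2) *: 'X + (1 / 2 - x)%:P)) - 'X ^+ n).
have pE y : p^`().[y] =
    S * (2 * n%:R * (n%:R - 1) * y ^+ m.+1 * ((1 + y) / 2 - x)).
  rewrite /p !derivF !hornerF.
  by rewrite !succnK !exprS; field.
have w0 : 0 <= (2 * x - 1)^\p by rewrite le_max lexx.
have wx : (2 * x - 1)^\p <= x by rewrite ge_max x0; lra.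
have wge : 2 * x - 1 <= (2 * x - 1)^\p by rewrite le_max lexx orbT.
(* This kills the boundary term at the lower limit, whether 2x - 1 is positive or not. *)
have ww : (2 * x - 1)^\p * ((2 * x - 1)^\p - (2 * x - 1)) = 0.
  rewrite /pos_part; case: (leP 0 (2 * x - 1)) => _; last by rewrite mul0r.
  by rewrite subrr mulr0.
have -> : S * (n%:R * (1 - x) * x ^+ m.+2 - x ^+ n + (2 * x - 1)^\p ^+ n)
    = p.[x] - p.[(2 * x - 1)^\p].
  rewrite /p !hornerF; set w := _^\p in ww *.
  transitivity (S * (n%:R * (1 - x) * x ^+ m.+2 - x ^+ n + w ^+ n
    - n%:R * w ^+ m.+1 * (w * (w - (2 * x - 1))))); first by rewrite ww; ring.
  by rewrite !exprS; field.
have LI F := @Linfty_inner (kerA n) bndA F x (lip3_kerA n) lip3_bndA bndA_le1.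
apply: (dist_integral_le w0 x1 wx (LI _ L1 x01) (LI _ L2 x01)) => y.
- move=> /andP[wy yx]; have y0 := le_trans w0 wy.
  by rewrite pE !mulr_ge0 ?exprn_ge0 ?subr_ge0 ?ler1n//; lra.
move=> /andP[wy yx]; right; split; first by rewrite wy.
have y0 := le_trans w0 wy; rewrite pE /kerA /bndA /= !subSS subn0.
apply: dist_inner_cst; first by rewrite !mulr_ge0 ?exprn_ge0 ?subr_ge0 ?ler1n.
by apply/andP; split; lra.
Qed.

(** For x >= 1/2 the substitution s = 2y - 1 turns the mass into half of that of the first kernel,
    taken at w instead of x. *)
Lemma dist_termC x (w := (2 * x - 1)^\p : R) : 0 <= x <= 1 ->
  `|termC n F1 x - termC n F2 x| <= S * ((n%:R * (1 - w) * w ^+ m.+2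
     - w ^+ n + (2 * w - 1)^\p ^+ n) / 2).
Proof.
move=> x01; have /andP[x0 x1] := x01.
pose p : {poly R} := S *: ((2 * n%:R) *: ((2%:P * 'X - 1%:P) ^+ m.+2 *
  ((1 / 2) *: 'X + (1 / 2 - x)%:P)) - (1 / 2) *: (2%:P * 'X - 1%:P) ^+ n).
have pE y : p^`().[y] =
    S * (4 * n%:R * (n%:R - 1) * (2 * y - 1) ^+ m.+1 * ((1 + y) / 2 - x)).
  rewrite /p !derivF !hornerF.
  by rewrite !succnK !exprS; field.
pose a := Num.max (1 / 2) (2 * x - 1); pose b := Num.max (1 / 2) x.
have a2 : 1 / 2 <= a by rewrite le_max lexx.
have a0 : 0 <= a by apply: le_trans a2; lra.
have b1 : b <= 1 by rewrite ge_max x1; lra.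
have ab : a <= b by rewrite ge_max !le_max lexx /=; apply/orP; right; lra.
have -> : S * ((n%:R * (1 - w) * w ^+ m.+2 - w ^+ n
    + (2 * w - 1)^\p ^+ n) / 2) = p.[b] - p.[a].
  (* For x >= 1/2, the product in [p] vanishes at the lower limit: the length is 0 at 2x - 1, and
     the power is 0 at 1/2. For x < 1/2, both limits are 1/2 and w = 0, so both sides vanish. *)
  rewrite /p !hornerF /a /b /w /pos_part; case: (leP (1 / 2) x) => xh.
    rewrite (@max_r _ _ 0 (2 * x - 1)); last lra.
    case: (leP (1 / 2) (2 * x - 1)) => wh.
      by rewrite max_r; [rewrite !exprS; field|lra].
    rewrite max_l; last lra.
    by rewrite !exprS; field.
  rewrite (max_l (x := 0) (y := 2 * x - 1)); last lra.
  rewrite !max_l; [|lra..].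
  by rewrite !exprS; field.
have yb y : y <= b -> a <= y -> 0 <= (1 + y) / 2 - x.
  by rewrite le_max ge_max => /orP[?|?] /andP[? ?]; lra.
have LI F := @Linfty_inner (kerC n) bndA F x (lip3_kerC n) lip3_bndA bndA_le1.
apply: (dist_integral_le a0 b1 ab (LI _ L1 x01) (LI _ L2 x01)) => y.
- move=> /andP[ay yb']; have := yb _ yb' ay; have := le_trans a2 ay => h1 h2.
  by rewrite pE !mulr_ge0 ?exprn_ge0 ?subr_ge0 ?ler1n//; lra.
move=> /andP[ay yb']; right; split; first by rewrite ay.
have h2 := yb _ yb' ay; have h1 := le_trans a2 ay.
rewrite pE /kerC /bndA /= !subSS subn0.
apply: dist_inner_cst.
  by rewrite !mulr_ge0 ?exprn_ge0 ?subr_ge0 ?ler1n//; lra.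
apply/andP; split=> //; have := le_trans yb' b1; lra.
Qed.

(** With u = 3y - 2x, the positive part is supported on z <= u / 2. Integrating over all of
    [0, u / 2] instead of [0, b] gives a bound free of the minimum in the upper limit. *)
Lemma dist_innerB x y b : 0 <= x <= 1 -> 0 <= y <= 1 -> b <= 1 ->
  0 <= 3 * y - 2 * x ->
  `|interval_integral 0 b (fun z => kerB n (x, y, z) * F1 z)
    - interval_integral 0 b (fun z => kerB n (x, y, z) * F2 z)|
  <= S * (n%:R * (3 * y - 2 * x) ^+ m.+2).
Proof.
move=> x01 y01 b1 u0; set u := 3 * y - 2 * x in u0 *.
pose p : {poly R} := - (S * n%:R) *: (u%:P - 2%:P * 'X) ^+ m.+2.
have pE z : p^`().[z] = S * (2 * n%:R * (n%:R - 1) * (u - 2 * z) ^+ m.+1).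
  rewrite /p !derivF !hornerF.
  by rewrite !succnK !exprS; field.
have -> : S * (n%:R * u ^+ m.+2) = p.[u / 2] - p.[0].
  have uu : u - 2 * (u / 2) = 0 by field.
  by rewrite /p !hornerF uu mulr0 subr0 expr0n mulr0 sub0r mulNr opprK mulrA.
have LM F : Linfty F -> Linfty (fun z => kerB n (x, y, z) * F z).
  move=> LF.
  exact: (Linfty_mul (lip1_Linfty (lip3_lip1 (lip3_kerB n) x01 y01)) LF).
have c0 : 0 <= 2 * n%:R * (n%:R - 1) :> R.
  by rewrite !mulr_ge0 ?subr_ge0 ?ler1n.
have u2 : 0 <= u / 2 by rewrite divr_ge0.
apply: (dist_integral_le (lexx 0) b1 u2 (LM _ L1) (LM _ L2)) => z.
  move=> /andP[z0 zu]; rewrite pE (mulr_ge0 S0)// (mulr_ge0 c0)// exprn_ge0//.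
  by rewrite subr_ge0 mulrC -ler_pdivlMr.
move=> /andP[z0 zb]; rewrite -mulrBr /kerB /= !subSS subn0 -/u /pos_part.
(* Beyond u / 2 the kernel is a power of 0 with positive exponent m + 1, so both integrands
   vanish. *)
have [uz|uz] := leP (u - 2 * z) 0.
  by left; rewrite expr0n /= mulr0 !mul0r.
right; split.
  by rewrite z0 ler_pdivlMr// mulrC -subr_ge0 ltW.
rewrite pE normrM ger0_norm ?(mulr_ge0 c0) ?exprn_ge0 ?(ltW uz)//.
rewrite [leRHS]mulrC ler_wpM2l ?(mulr_ge0 c0) ?exprn_ge0 ?(ltW uz)//.
by apply/dS/andP; split; [|exact: le_trans zb b1].
Qed.

(** The inner bound n (3y - 2x)^(n-1) is integrated from 2x / 3, where it starts to be positive, up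
    to x. *)
Lemma dist_termB x : 0 <= x <= 1 ->
  `|termB n F1 x - termB n F2 x| <= S * (x ^+ n / 3).
Proof.
move=> x01; have /andP[x0 x1] := x01.
pose p : {poly R} := (S / 3) *: (3%:P * 'X - (2 * x)%:P) ^+ n.
have pE y : p^`().[y] = S * (n%:R * (3 * y - 2 * x) ^+ m.+2).
  rewrite /p !derivF !hornerF.
  by rewrite !succnK !exprS; field.
have -> : S * (x ^+ n / 3) = p.[x] - p.[2 * x / 3].
  have e0 : 3 * (2 * x / 3) - 2 * x = 0 by field.
  have e1 : 3 * x - 2 * x = x by ring.
  by rewrite /p !hornerF e0 e1 expr0n mulr0 subr0; ring.
pose a := Num.max (x - 1 / 4)^\p (2 * x - 1).
have a0 : 0 <= a by rewrite !le_max lexx.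
have ab : 2 * x / 3 <= x by lra.
have LI F := @Linfty_inner (kerB n) bndB F x (lip3_kerB n) lip3_bndB bndB_le1.
apply: (dist_integral_le a0 x1 ab (LI _ L1 x01) (LI _ L2 x01)) => y.
  move=> /andP[wy yx]; rewrite pE (mulr_ge0 S0)// mulr_ge0//.
  by rewrite exprn_ge0//; lra.
move=> /andP[ay yx]; have y0 := le_trans a0 ay.
have y01 : 0 <= y <= 1 by rewrite y0 (le_trans yx).
have b1 : bndB (x, y, 0) <= 1 by apply: bndB_le1; split; rewrite //= lexx ler01.
(* For y < 2x / 3 the kernel vanishes at every z >= 0, so the two inner integrals coincide. *)
have [u0|u0] := leP 0 (3 * y - 2 * x); last first.
  left; apply: eq_Rintegral => z; rewrite inE /= in_itv /= => /andP[z0 _].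
  rewrite /kerB /= !subSS subn0 /pos_part.
  by rewrite max_l ?expr0n /= ?mulr0 ?mul0r//; lra.
right; split; first by rewrite yx andbT; lra.
by rewrite pE; exact: dist_innerB.
Qed.

End Bounds.
End Terms.

(** * The sup norm and the contraction estimate *)

Section SupNorm.
Context (R : realType).
Implicit Type f : R -> R.

Lemma le_sup_norm f x : Linfty f -> 0 <= x <= 1 -> `|f x| <= sup_norm f.
Proof.
move=> Lf x01; have [M M0 Mf] := Linfty_bound Lf.
apply: ub_le_sup; last by exists x; rewrite //= in_itv.
by exists M => _ [t /= t01 <-]; apply: Mf; rewrite in_itv in t01.
Qed.

Lemma sup_norm_le f M : (forall x, 0 <= x <= 1 -> `|f x| <= M) ->
  sup_norm f <= M.
Proof.
move=> Mf; apply: ge_sup.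
  by exists `|f 0|, 0; rewrite //= in_itv /= lexx ler01.
by move=> _ [t /= t01 <-]; apply: Mf; rewrite in_itv in t01.
Qed.

Lemma LinftyB f g : Linfty f -> Linfty g -> Linfty (f \- g).
Proof.
move=> Lf Lg; have [[M M0 Mf] [N N0 Ng]] := (Linfty_bound Lf, Linfty_bound Lg).
apply: (@LinftyI _ _ (M + N)) => [|t t01]; last first.
  by apply: le_trans (ler_normB _ _) _; rewrite lerD ?Mf ?Ng.
by case: Lf Lg => mf _ [mg _]; exact: measurable_funB.
Qed.

(** Here [r] stands for the value of [FA], which cancels in the difference of two values of
    [Omega]. *)
Lemma dist_sum3 (r a1 a2 b1 b2 c1 c2 : R) :
  `|r - a1 - b1 + c1 - (r - a2 - b2 + c2)|
    <= `|a1 - a2| + `|b1 - b2| + `|c1 - c2|.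
Proof.
have -> : r - a1 - b1 + c1 - (r - a2 - b2 + c2)
  = (a2 - a1) + (b2 - b1) + (c1 - c2) by ring.
rewrite [`|a1 - _|]distrC [`|b1 - _|]distrC.
by rewrite (le_trans (ler_normD _ _))// lerD2r ler_normD.
Qed.

Lemma sup_norm_Omega_le m (F1 F2 : R -> R) : Linfty F1 -> Linfty F2 ->
  sup_norm (Omega m.+3 F1 \- Omega m.+3 F2) <= 3 / 4 * sup_norm (F1 \- F2).
Proof.
move=> L1 L2; set S := sup_norm (F1 \- F2).
have dS (t : R) : 0 <= t <= 1 -> `|F1 t - F2 t| <= S.
  exact: (@le_sup_norm (F1 \- F2) t (LinftyB L1 L2)).
have S0 : 0 <= S.
  by apply: le_trans (normr_ge0 _) (dS 0 _); rewrite lexx ler01.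
apply: sup_norm_le => x x01 /=; rewrite !OmegaE.
have hA := dist_termA m L1 L2 dS x01.
have hB := dist_termB m L1 L2 dS x01.
have hC := dist_termC m L1 L2 dS x01.
rewrite mulrC; apply: le_trans (ler_wpM2l S0
  (@kernel_mass_le _ m x x01)).
rewrite (mulrDr S) (mulrDr S); apply: le_trans (lerD (lerD hA hB) hC).
exact: dist_sum3.
Qed.

End SupNorm.

Theorem theorem3 (R : realType) (n : nat) (hn : (3 <= n)%N) :
  exists Cn : R, Cn <= 11 / 12 /\ contraction_on_Linfty Cn (@Omega R n).
Proof.
(* Writing n = m + 3 makes the natural subtractions n - 1 and n - 2 exact. The total kernel mass 3/4
   serves as the constant. *)
case: n hn => [|[|[|m]]]// _; exists (3 / 4); split; first lra.
split; [lra|lra|by move=> F /(Linfty_Omega m.+3)|].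
by move=> F1 F2 L1 L2; exact: sup_norm_Omega_le.
Qed.
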